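(* Let $G$ be a free abelian group (written additively) and $A$ a non-empty subset of $G$. (1) If $A=\{a+n_1b_1+\cdots+n_db_d : n_i\in[0,m_i]\cap\mathbb{Z},\ 1\le i\le d\}$ for some $a,b_1,\dots,b_d\in G$ and $m_1,\dots,m_d\in\mathbb{Z}_{\ge0}$ (in particular if $A=\{a+nb: n\in[0,m]\cap\mathbb{Z}\}$), then $A$ is a minimal complement to some subset of $G$, and $A$ has a minimal complement in $G$. (2) If $A=\{a+nb:n\in\mathbb{Z}_{\ge0}\}$ with $b\neq 0$, or more generally if $A$ is an unbounded generalised arithmetic progression of dimension $d$ with respect to $b_1,\dots,b_d\in G$ where $b_1,\dots,b_d$ generate a free subgroup of $G$ of rank $d$, then $A$ is not a minimal complement to any subset of $G$, and $A$ has no minimal complement in $G$. (3) If $G=\mathbb{Z}^{\mathbb{I}}$ for some index set $\mathbb{I}$ and $A=P^{\mathbb{I}}$ where $P=\{a+nb:n\in\mathbb{Z}_{\ge0}\}\subseteq\mathbb{Z}$ with $a\in\mathbb{Z}$, $b\in\mathbb{Z}\setminus\{0\}$, then $A$ is not a minimal complement to any subset of $G$, and $A$ has no minimal complement in $G$. Thus the subsets in (2) and (3) belong to no minimal pair.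
   Context: For non-empty subsets $A,B$ of an abelian group $G$, $A$ is a minimal complement of $B$ if $A+B=G$ and $(A\setminus\{a\})+B\neq G$ for all $a\in A$. A minimal pair is a pair $(A,B)$ with $A+B=G$ in which at least one set is a minimal complement of the other. An unbounded arithmetic progression in $\mathbb{Z}$ is a set $\{c+nt:n\in\mathbb{Z}_{\ge0}\}$ with $c\in\mathbb{Z}$, $t\neq0$. An infinite subset $X\subseteq G$ is an unbounded generalised arithmetic progression of dimension $d$ with respect to $b_1,\dots,b_d\in G$ if there is $a\in G$ with $X=\{a+n_1b_1+\cdots+n_db_d : n_i\in F_i\}$ for subsets $F_1,\dots,F_d\subseteq\mathbb{Z}$ each of which is either an unbounded arithmetic progression in $\mathbb{Z}$ or a finite set. *)

(* Defs.v *)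
From HB Require Import structures.
From mathcomp Require Import all_boot all_order all_algebra.
From mathcomp Require Import all_classical.

Set Implicit Arguments.
Unset Strict Implicit.
Unset Printing Implicit Defensive.

Import Order.TTheory GRing.Theory Num.Theory.
Local Open Scope classical_set_scope.
Local Open Scope ring_scope.

Definition sumset (G : zmodType) (A B : set G) : set G :=
  [set a + b | a in A & b in B].

(* [minimal_complement A B]: A is a minimal complement of (or to) B. *)
Definition minimal_complement (G : zmodType) (A B : set G) : Prop :=
  [/\ A !=set0, B !=set0, sumset A B = setT
    & forall a, A a -> sumset (A `\ a) B <> setT].

Definition minimal_pair (G : zmodType) (A B : set G) : Prop :=
  [/\ A !=set0, B !=set0, sumset A B = setT
    & minimal_complement A B \/ minimal_complement B A].

Definition is_subgroup (G : zmodType) (H : set G) : Prop :=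
  H 0 /\ forall x y, H x -> H y -> H (x - y).

Definition generated (G : zmodType) (S : set G) : set G :=
  smallest (@is_subgroup G) S.

(* A family, possibly infinite, is Z-linearly independent when the only
   vanishing finite integer combination is the trivial one. *)
Definition Zindependent (G : zmodType) (I : choiceType) (e : I -> G) : Prop :=
  forall (s : seq I) (c : I -> int), uniq s ->
    \sum_(i <- s) e i *~ c i = 0 -> forall i, i \in s -> c i = 0.

Definition Zbasis (G : zmodType) (I : choiceType) (e : I -> G) (H : set G) :
    Prop :=
  Zindependent e /\ generated (range e) = H.

Definition free_abelian (G : zmodType) : Prop :=
  exists (I : choiceType) (e : I -> G), Zbasis e setT.

Definition free_of_rank (G : zmodType) (d : nat) (H : set G) : Prop :=
  exists e : 'I_d -> G, Zbasis e H.

Definition progression (G : zmodType) (d : nat) (a : G) (b : 'I_d -> G)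
    (F : 'I_d -> set int) : set G :=
  [set a + \sum_(i < d) b i *~ n i | n in [set n | forall i, F i (n i)]].

Definition unbounded_ap (X : set int) : Prop :=
  exists c t : int, t != 0 /\ X = [set c + t *+ n | n in [set: nat]].

Definition unbounded_gap (G : zmodType) (d : nat) (b : 'I_d -> G)
    (X : set G) : Prop :=
  infinite_set X /\
  exists (a : G) (F : 'I_d -> set int),
    (forall i, unbounded_ap (F i) \/ finite_set (F i)) /\
    X = progression a b F.

(* Main.v *)
(** For (2) and (3) the point is that every [x] in [A] admits a translation [c]
    with [A + c] contained in [A] and [x - c] outside [A].  If [A + B = G], then
    [A + c] is also a complement of [B] and misses [x], so [x] may be dropped
    from [A].  Likewise, if [g] is covered by [b] and [x] in [A], then [g - c]
    is covered by some [b' <> b] in [B], and so is [g]; hence [b] may be dropped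
    from [B].

    For (1) only the finiteness of [A] matters. *)

Require Import Defs.
From HB Require Import structures.
From mathcomp Require Import all_boot all_order all_algebra.
From mathcomp Require Import all_classical.

Set Implicit Arguments.
Unset Strict Implicit.
Unset Printing Implicit Defensive.

Import Order.TTheory GRing.Theory Num.Theory.
Local Open Scope classical_set_scope.
Local Open Scope ring_scope.

(** * Sumsets as coverings *)

Lemma sumsetC (G : zmodType) (A B : set G) : sumset A B = sumset B A.
Proof.
by apply/seteqP; split=> _ [x Ax [y By <-]]; exists y => //; exists x => //;
  rewrite addrC.
Qed.

Lemma sumset_setT (G : zmodType) (A B : set G) :
  sumset A B = setT <-> forall x, exists2 y, A y & B (x - y).
Proof.
split=> [AB x | AB].
  have [y Ay [z Bz <-]] : sumset A B x by rewrite AB.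
  by exists y => //; rewrite addrAC subrr add0r.
apply/seteqP; split=> // x _; have [y Ay Bxy] := AB x.
by exists y => //; exists (x - y) => //; rewrite addrC subrK.
Qed.

(** * Sets that shrink under translation *)

Definition shrinkable (G : zmodType) (A : set G) : Prop :=
  forall x, A x -> exists c, (forall y, A y -> A (y + c)) /\ ~ A (x - c).

Lemma shrinkable_not_minimal_complement (G : zmodType) (A B : set G) :
  shrinkable A -> ~ minimal_complement A B.
Proof.
move=> shA [[x Ax] _ /sumset_setT AB /(_ x Ax)]; apply.
have [c [Ac nAxc]] := shA x Ax.
apply/sumset_setT => g; have [y Ay Bgy] := AB (g - c).
exists (y + c); last by rewrite opprD addrA addrAC.
by split; [exact: Ac | move=> /= yx; apply: nAxc; rewrite -yx addrK].
Qed.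

Lemma shrinkable_no_minimal_complement (G : zmodType) (A B : set G) :
  shrinkable A -> ~ minimal_complement B A.
Proof.
move=> shA [[b Bb] _ BA /(_ b Bb)]; apply.
move/sumset_setT: BA => BA.
apply/sumset_setT => g; have [b1 Bb1 Ab1] := BA g.
have [eqb|neb] := pselect (b1 = b); last by exists b1.
have [c [Ac nAc]] := shA _ Ab1.
have [b2 Bb2 Ab2] := BA (g - c).
exists b2; last by have := Ac _ Ab2; rewrite addrAC subrK.
(* If [b2] were [b], then [g - c - b2] would be the point [g - b1 - c] excluded from [A]. *)
by split=> //= eqb2; apply: nAc; rewrite addrAC eqb -eqb2.
Qed.

Lemma shrinkable_no_minimal_pair (G : zmodType) (A : set G) :
  shrinkable A ->
  [/\ ~ (exists B, minimal_complement A B),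
      ~ (exists B, minimal_complement B A)
    & ~ (exists B, minimal_pair A B \/ minimal_pair B A)].
Proof.
move=> shA.
have nAB := shrinkable_not_minimal_complement shA.
have nBA := shrinkable_no_minimal_complement shA.
by split=> -[B]; [exact: nAB | exact: nBA |];
  by case=> -[_ _ _ []]; [exact: nAB | exact: nBA | exact: nBA | exact: nAB].
Qed.

(** * Finite sets *)

(** Of two members of a chain the larger contains both, so induction on [s] keeps one member for all
    points met so far; [X] serves the empty list. *)
Lemma chain_cover_seq (T : eqType) (F : set (set T)) (X : set T) (s : seq T) :
  total_on F subset -> F X ->
  (forall x, x \in s -> exists2 Y, F Y & Y x) ->
  exists2 Y, F Y & forall x, x \in s -> Y x.
Proof.
move=> Ftot FX; elim: s => [|x s IHs] Fs; first by exists X.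
have [|Y FY Ys] := IHs; first by move=> y ys; apply: Fs; rewrite inE ys orbT.
have [Z FZ Zx] := Fs x (mem_head _ _).
have [YZ|ZY] := Ftot _ _ FY FZ; [exists Z => // | exists Y => //] => y.
  by rewrite inE => /predU1P[-> // | /Ys /YZ].
by rewrite inE => /predU1P[-> | /Ys //]; exact: ZY.
Qed.

(* Zorn's lemma is applied to the complements of the sets [B] with
   [A + B = G]; finiteness of [A] makes these closed under unions of chains. *)
Lemma finite_has_minimal_complement (G : zmodType) (A : set G) :
  finite_set A -> A !=set0 -> exists B, minimal_complement B A.
Proof.
move=> /finite_seqP[s ->] [a /= sa].
pose P X := sumset [set` s] (~` X) = setT.
have [|X [PX maxX]] := @Zorn_bigcup G P.
  move=> F FP Ftot; apply/sumset_setT => g; apply: contrapT => ng.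
  have cov y : y \in s -> exists2 Y, F Y & Y (g - y).
    by move=> sy; apply: contrapT => nY; apply: ng; exists y => // -[Y FY Yy];
      apply: nY; exists Y.
  have [Y0 FY0 _] := cov a sa.
  have [|Y FY Ys] := @chain_cover_seq _ F Y0 [seq g - y | y <- s] Ftot FY0.
    by move=> _ /mapP[y sy ->]; exact: cov.
  have /sumset_setT /(_ g) [y sy] := FP Y FY; apply.
  by apply: Ys; apply: map_f.
have XA : sumset (~` X) [set` s] = setT by rewrite sumsetC.
exists (~` X); split=> //; last 2 first.
- by exists a.
(* Dropping [b] from the complement of [X] means adding [b] to [X], which maximality forbids. *)
- move=> b nXb bA; apply: (maxX (X `|` [set b])).
    by split=> [x Xx | XbX]; [left | apply: nXb; apply: XbX; right].
  by rewrite /P setCU -setDE sumsetC.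
- by move/sumset_setT: XA => /(_ 0) [x nXx _]; exists x.
Qed.

(** The values are chosen one at a time: each new one has only finitely many positions to avoid.
    Both signs occur in [bad] because [D] need not be symmetric. *)
Lemma separated_family (G : zmodType) (D s : seq G) :
  infinite_set [set: G] ->
  exists h : G -> G, forall x y, x \in s -> y \in s -> x != y ->
    h x - h y \notin D.
Proof.
move=> infG; elim: s => [|a s [h hP]]; first by exists id.
pose bad := [seq h x + d | x <- s, d <- D] ++ [seq h x - d | x <- s, d <- D].
have [z nbad] : exists z, z \notin bad.
  apply: contrapT => nz; apply: infG; apply/finite_seqP; exists bad.
  apply/seteqP; split=> // z _ /=; apply: contrapT => /negP nz'.
  by apply: nz; exists z.
exists (fun x => if x == a then z else h x) => x y.
rewrite !inE; move: nbad; rewrite mem_cat negb_or => /andP[nD nN].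
have [-> _|nxa /= sx] := eqVneq x a; have [->|nya /= sy] := eqVneq y a => //=.
- move=> _; apply: contra nD => Dzy; apply/allpairsP.
  by exists (y, z - h y); split=> //=; rewrite addrC subrK.
- move=> _ _; apply: contra nN => Dxz; apply/allpairsP.
  by exists (x, h x - z); split=> //=; rewrite subKr.
- exact: hP.
Qed.

Lemma subr_swap (G : zmodType) (x y z t : G) : x - y = z - t -> t - y = z - x.
Proof.
by move=> E; rewrite -(subKr z t) -E opprB addrA addrAC addrK.
Qed.

(* With the points [h a] far apart, remove from [G] all [h a - a'] with
   [a' != a]; then [h a] can only be covered by [a], while a translate of [-A]
   meets at most one of the removed clusters, of size [#|A| - 1]. *)
Lemma finite_is_minimal_complement (G : zmodType) (A : set G) :
  infinite_set [set: G] -> finite_set A -> A !=set0 ->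
  exists B, minimal_complement A B.
Proof.
move=> infG /finite_seqP[s0 ->].
have [s us ss0] : exists2 s, uniq s & s =i s0.
  by exists (undup s0); [exact: undup_uniq | exact: mem_undup].
have -> : [set` s0] = [set` s].
  by apply/seteqP; split=> x /=; rewrite ss0.
move=> [a0 /= sa0].
(* If [x - y] and [x - y'] lie in the clusters of [a] and [c], then [h a - h c] is a difference of
   two differences of elements of [s]. *)
pose D := [seq d - e | d <- [seq x - y | x <- s, y <- s],
                       e <- [seq x - y | x <- s, y <- s]].
have [h hP] := separated_family D s infG.
pose R := [set z | exists a a', [/\ a \in s, a' \in s, a' != a & z = h a - a']].
have AB : sumset [set` s] (~` R) = setT.
  apply/sumset_setT => x; apply: contrapT => nx.
  have xR y : y \in s -> R (x - y).
    by move=> sy; apply: contrapT => nR; apply: nx; exists y.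
  have [a [a' [sa sa' _ xa0]]] := xR _ sa0.
  (* For an uncovered [x], separation puts all [x - y] in the cluster of the same [a], so
     translation by [h a - x] injects [s] into [s] without [a]. *)
  have sub y : y \in s -> h a - x + y \in rem a s.
    move=> sy; have [c [c' [sc sc' ncc xy]]] := xR _ sy.
    have eqac : a = c.
      apply/eqP; apply: contraT => nac; case/negP: (hP _ _ sa sc nac).
      have -> : h a - h c = (a' - a0) - (c' - y).
        by rewrite (subr_swap xa0) (subr_swap xy) opprB addrA subrK.
      by apply: allpairs_f; apply: allpairs_f.
    rewrite mem_rem_uniq // !inE eqac.
    by rewrite -(subr_swap xy) subrK ncc.
  have subs : {subset [seq h a - x + y | y <- s] <= rem a s}.
    by move=> _ /mapP[y sy ->]; exact: sub.
  have us' : uniq [seq h a - x + y | y <- s].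
    by rewrite map_inj_uniq //; exact: addrI.
  have := uniq_leq_size us' subs; rewrite size_map size_rem //.
  by case: (s) sa => //= y t _; rewrite ltnn.
exists (~` R); split=> //.
- by exists a0.
- by move/sumset_setT: AB => /(_ 0) [y _ Ry]; exists (0 - y).
- move=> a sa /sumset_setT /(_ (h a)) [y [sy /eqP nya]]; apply.
  by exists a, y.
Qed.

(** This settles the trivial group, which has no room for points far apart. *)
Lemma trivial_is_minimal_complement (G : zmodType) (A : set G) :
  (forall x : G, x = 0) -> A !=set0 -> exists B, minimal_complement A B.
Proof.
move=> G0 A0; exists setT; split=> //; first by exists 0.
  apply/sumset_setT => x; case: A0 => a Aa; by exists a.
move=> a Aa /sumset_setT /(_ 0) [y [_ +] _]; apply => /=.
by rewrite (G0 y) (G0 a).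
Qed.

(** * Integer combinations in free abelian groups *)

Lemma generated_sub (G : zmodType) (S H : set G) :
  is_subgroup H -> S `<=` H -> generated S `<=` H.
Proof. by move=> sgH SH x; apply. Qed.

Lemma generated_mem (G : zmodType) (S : set G) : S `<=` generated S.
Proof. by move=> x Sx H [_]; apply. Qed.

Lemma sum_support (G : zmodType) (I : choiceType) (e : I -> G) (c : I -> int)
    (s t : seq I) :
  uniq s -> uniq t -> {subset s <= t} -> (forall i, i \notin s -> c i = 0) ->
  \sum_(i <- t) e i *~ c i = \sum_(i <- s) e i *~ c i.
Proof.
move=> us ut st cs.
rewrite (bigID (mem s)) /= [X in _ + X]big1 ?addr0; last first.
  by move=> i /cs ->; rewrite mulr0z.
rewrite -big_filter; apply: perm_big; apply: uniq_perm => //.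
  exact: filter_uniq.
by move=> i; rewrite mem_filter andb_idr //; exact: st.
Qed.

(** Coefficients vanish off [s], so that two combinations can be rewritten over a common support and
    subtracted. *)
Lemma generated_combination (G : zmodType) (I : choiceType) (e : I -> G) x :
  generated (range e) x ->
  exists s (c : I -> int), [/\ uniq s, forall i, i \notin s -> c i = 0
    & x = \sum_(i <- s) e i *~ c i].
Proof.
move: x; apply: generated_sub; last first.
  move=> _ [i _ <-]; exists [:: i], (fun j => (j == i)%:Z).
  split=> //; last by rewrite big_seq1 eqxx mulr1z.
  by move=> j; rewrite inE => /negbTE ->.
split; first by exists [::], (fun=> 0); split; rewrite ?big_nil.
move=> _ _ [s [c [us cs ->]]] [t [d [ut dt ->]]].
exists (undup (s ++ t)), (fun i => c i - d i); split; first exact: undup_uniq.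
  move=> i; rewrite mem_undup mem_cat negb_or => /andP[/cs -> /dt ->].
  by rewrite subr0.
under [RHS]eq_bigr => i _ do rewrite mulrzBr.
rewrite sumrB; congr (_ - _); apply/esym/sum_support;
  rewrite ?undup_uniq // => i; rewrite mem_undup mem_cat => ->//.
by rewrite orbT.
Qed.

Lemma free_abelian_torsion_free (G : zmodType) :
  free_abelian G -> forall (x : G) n, x *+ n.+1 = 0 -> x = 0.
Proof.
move=> [I [e [ind gen]]] x n.
have /generated_combination [s [c [us _ ->]]] : generated (range e) x.
  by rewrite gen.
rewrite -sumrMnl => sum0.
rewrite big_seq big1 // => i si.
suff -> : c i = 0 by rewrite mulr0z.
have /eqP : c i * n.+1 = 0.
  apply: (ind s (fun i => c i * n.+1)) si => //.
  by rewrite -[RHS]sum0; apply: eq_bigr => j _; rewrite mulrzA -pmulrn.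
by rewrite mulf_eq0 orbF => /eqP.
Qed.

Lemma free_abelian_infinite (G : zmodType) (x : G) :
  free_abelian G -> x != 0 -> infinite_set [set: G].
Proof.
move=> /free_abelian_torsion_free tf x0 /finite_seqP[s sT].
have inj m n : x *+ (m + n.+1) != x *+ m.
  by apply: contra x0; rewrite mulrnDr -[X in _ == X]addr0 => /eqP/addrI/tf ->.
(* Without torsion the multiples of [x] are distinct, and one more of them is taken than [s] can
   hold. *)
have us : uniq [seq x *+ k | k <- iota 0 (size s).+1].
  rewrite map_inj_uniq ?iota_uniq // => m n xmn.
  case: (ltngtP m n) => // [lt_mn|lt_nm].
    by have := inj m (n - m.+1)%N; rewrite addnS -addSn subnKC // xmn eqxx.
  by have := inj n (m - n.+1)%N; rewrite addnS -addSn subnKC // xmn eqxx.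
have /(uniq_leq_size us) : {subset [seq x *+ k | k <- iota 0 (size s).+1] <= s}.
  by move=> y _; have : [set: G] y by []; rewrite sT.
by rewrite size_map size_iota ltnn.
Qed.

Lemma generated_ord_combination (G : zmodType) d (b : 'I_d -> G) x :
  generated (range b) x -> exists c : 'I_d -> int, x = \sum_i b i *~ c i.
Proof.
move: x; apply: generated_sub.
  split; first by exists (fun=> 0); rewrite big1.
  move=> _ _ [c ->] [c' ->]; exists (fun i => c i - c' i).
  by rewrite -sumrB; apply: eq_bigr => i _; rewrite mulrzBr.
move=> _ [i _ <-]; exists (fun j => (j == i)%:Z).
rewrite (bigD1 i) //= eqxx mulr1z big1 ?addr0 // => j /negbTE ->.
by rewrite mulr0z.
Qed.

Lemma Zindependent_ord (G : zmodType) d (e : 'I_d -> G) :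
  Zindependent e ->
  forall c : 'I_d -> int, \sum_i e i *~ c i = 0 -> forall i, c i = 0.
Proof.
move=> ind c c0 i; apply: (ind (index_enum 'I_d)) => //.
  exact: index_enum_uniq.
exact: mem_index_enum.
Qed.

Lemma sum_intmul_exchange (G : zmodType) d (u v : 'I_d -> G)
    (M : 'I_d -> 'I_d -> int) (c : 'I_d -> int) :
  (forall i, u i = \sum_j v j *~ M i j) ->
  \sum_i u i *~ c i = \sum_j v j *~ (\sum_i c i * M i j).
Proof.
move=> uE; rewrite (eq_bigr (fun i => \sum_j v j *~ (c i * M i j))).
  by rewrite exchange_big; apply: eq_bigr => j _; rewrite -mulrz_sumr.
move=> i _; rewrite uE mulrz_suml; apply: eq_bigr => j _.
by rewrite mulrC mulrzA.
Qed.

(* If [e = M b] with [e] a basis and [b = N e] then [M N = 1], hence [N M = 1]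
   because a one-sided inverse of a square integer matrix is two-sided. *)
Lemma free_of_rank_independent (G : zmodType) d (b : 'I_d -> G) :
  free_of_rank d (generated (range b)) ->
  forall c : 'I_d -> int, \sum_i b i *~ c i = 0 -> forall i, c i = 0.
Proof.
move=> [e [/Zindependent_ord ind gen]].
have /choice[M eM] : forall i, exists c : 'I_d -> int, e i = \sum_j b j *~ c j.
  move=> i; apply: generated_ord_combination; rewrite -gen.
  by apply: generated_mem; exists i.
have /choice[N bN] : forall i, exists c : 'I_d -> int, b i = \sum_j e j *~ c j.
  move=> i; apply: generated_ord_combination; rewrite gen.
  by apply: generated_mem; exists i.
pose M' := \matrix_(i, j) M i j; pose N' := \matrix_(i, j) N i j.
have MN : M' *m N' = 1%:M.
  apply/matrixP => i k; rewrite !mxE; apply/eqP; rewrite -subr_eq0; apply/eqP.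
  (* Substituting [b = N e] into [e = M b] makes row [i] of [M N - 1] a relation among the
     independent [e]. *)
  move: k; apply: ind.
  under eq_bigr => k _ do rewrite mulrzBr.
  rewrite sumrB [X in _ - X](bigD1 i) //= eqxx mulr1z [X in _ - (_ + X)]big1; last first.
    by move=> k /negbTE; rewrite eq_sym => ->; rewrite mulr0z.
  rewrite addr0 eM (sum_intmul_exchange _ bN); apply/eqP; rewrite subr_eq0.
  apply/eqP; apply: eq_bigr => k _; congr (_ *~ _).
  by apply: eq_bigr => j _; rewrite !mxE.
have NM := mulmx1C MN.
move=> c; rewrite (sum_intmul_exchange _ bN) => /ind cN.
(* A relation [c] among the [b] gives [c N = 0], hence [c = c N M = 0]. *)
have cN0 : (\row_i c i) *m N' = 0.
  apply/rowP => j; rewrite !mxE -[RHS](cN j).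
  by apply: eq_bigr => i _; rewrite !mxE.
move=> i; have : (\row_i c i) *m N' *m M' = 0 by rewrite cN0 mul0mx.
by rewrite -mulmxA NM mulmx1 => /rowP/(_ i); rewrite !mxE.
Qed.

(** * Progressions *)

Lemma progression_finite (G : zmodType) d (a : G) (b : 'I_d -> G)
    (F : 'I_d -> set int) :
  (forall i, finite_set (F i)) -> finite_set (progression a b F).
Proof.
move=> finF.
have /choice[s Fs] : forall i, exists s : seq int, F i = [set` s].
  by move=> i; apply/finite_seqP.
(* A common bound lets one finite type index all coordinates; indices past the end of a list give
   the default 0, harmless since only an inclusion is needed. *)
pose K := \max_i size (s i).
pose f (k : {ffun 'I_d -> 'I_K.+1}) := a + \sum_i b i *~ nth 0 (s i) (k i).
apply: (@sub_finite_set _ _ (range f)); last first.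
  by apply: finite_image; exact: finite_finset.
move=> _ [n Fn <-]; exists [ffun i => inord (index (n i) (s i))] => //.
rewrite /f; congr (_ + _); apply: eq_bigr => i _.
have sni : n i \in s i by have := Fn i; rewrite Fs.
rewrite ffunE inordK ?nth_index // ltnS.
by rewrite (leq_trans (index_size _ _)) // /K leq_bigmax.
Qed.

Lemma sum_add_single (G : zmodType) d (b : 'I_d -> G) (n : 'I_d -> int) i0 z :
  \sum_i b i *~ (n i + z *+ (i == i0)) = \sum_i b i *~ n i + b i0 *~ z.
Proof.
under eq_bigr => i _ do rewrite mulrzDr.
rewrite big_split /= [X in _ + X](bigD1 i0) //= eqxx mulr1n; congr (_ + _).
rewrite big1 ?addr0 //.
by move=> i /negbTE ->; rewrite mulr0n mulr0z.
Qed.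

(* The translation vector moves the [i0]-th coordinate of [x] just below the
   origin of the unbounded progression [F i0]. *)
Lemma progression_shrinkable (G : zmodType) d (a : G) (b : 'I_d -> G)
    (F : 'I_d -> set int) i0 :
  (forall c : 'I_d -> int, \sum_i b i *~ c i = 0 -> forall i, c i = 0) ->
  unbounded_ap (F i0) -> shrinkable (progression a b F).
Proof.
move=> ind [c0 [t [t0 Fi0]]] _ [n Fn <-].
have [k _ nk] : [set c0 + t *+ n | n in [set: nat]] (n i0).
  by rewrite -Fi0; exact: Fn.
exists (b i0 *~ (t *+ k.+1)); split.
  move=> _ [m Fm <-]; exists (fun i => m i + t *+ k.+1 *+ (i == i0)).
    move=> i /=; have [->|_] := eqVneq i i0; last by rewrite addr0; exact: Fm.
    have := Fm i0; rewrite Fi0 => -[l _ <-].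
    by exists (l + k.+1)%N => //; rewrite mulr1n mulrnDr addrA.
  by rewrite sum_add_single addrA.
move=> [m Fm]; rewrite -addrA -mulrNz -sum_add_single => /addrI eqs.
(* Independence makes coordinates unique, so [m i0] is [c0 - t], which no [c0 + t *+ l] equals. *)
have /(_ i0) : forall i, m i - (n i - t *+ k.+1 *+ (i == i0)) = 0.
  apply: ind; under eq_bigr => i _ do rewrite mulrzBr.
  rewrite sumrB eqs; apply/eqP; rewrite subr_eq0; apply/eqP.
  by apply: eq_bigr => i _; rewrite mulNrn.
rewrite eqxx mulr1n => /eqP; rewrite subr_eq0 => /eqP mi0.
have := Fm i0; rewrite Fi0 mi0 -nk => -[l _] /eqP.
rewrite -addrA mulrS opprD (addrCA _ (- t)) subrr addr0 => /eqP/addrI/eqP.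
by rewrite -addr_eq0 -mulrSr mulrn_eq0 /= (negbTE t0).
Qed.

(** Were every [F i] finite, the progression would be finite; so some coordinate is unbounded. *)
Lemma unbounded_gap_shrinkable (G : zmodType) d (b : 'I_d -> G) (A : set G) :
  free_of_rank d (generated (range b)) -> unbounded_gap b A -> shrinkable A.
Proof.
move=> /free_of_rank_independent ind [infA [a [F [apF defA]]]].
have [i0 apF0] : exists i, unbounded_ap (F i).
  apply: contrapT => nap; apply: infA; rewrite defA.
  apply: progression_finite => i; case: (apF i) => // api.
  by case: nap; exists i.
by rewrite defA; exact: progression_shrinkable ind apF0.
Qed.

Lemma ray_shrinkable (G : zmodType) (a b : G) :
  (forall n, b *+ n.+1 != 0) ->
  shrinkable [set a + b *+ n | n in [set: nat]].
Proof.
(* The shift by [k.+1] steps sends the chosen point back to [a - b]. *)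
move=> tfb _ [k _ <-]; exists (b *+ k.+1); split.
  by move=> _ [l _ <-]; exists (l + k.+1)%N => //; rewrite mulrnDr addrA.
move=> [l _] /eqP.
rewrite -addrA mulrS opprD (addrCA _ (- b)) subrr addr0 => /eqP/addrI/eqP.
by rewrite -addr_eq0 -mulrSr; apply/negP.
Qed.

Lemma product_ray_shrinkable (I : Type) (a b : int) :
  inhabited I -> b != 0 ->
  shrinkable
    [set f : I -> int | forall i, [set a + b *+ n | n in [set: nat]] (f i)].
Proof.
(* This vector carries [f] back to the constant function [a - b]; each of its coordinates is a
   positive multiple of [b]. *)
move=> [i0] b0 f Pf; exists (fun i => f i - (a - b)); split.
  move=> g Pg i; have [k _ fk] := Pf i; have [l _ gl] := Pg i.
  exists (l + k.+1)%N => //.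
  change ((g + (fun i => f i - (a - b))) i) with (g i + (f i - (a - b))).
  rewrite -fk -gl opprB mulrnDr -!addrA; do 2!congr (_ + _).
  by rewrite mulrSr addrA (addrC b) addrACA subrr add0r.
move=> /(_ i0) [l _]; change ((f - _) i0) with (f i0 - (f i0 - (a - b))).
rewrite subKr => /addrI/eqP.
by rewrite -addr_eq0 -mulrSr mulrn_eq0 (negbTE b0).
Qed.

Theorem theorem5p3 :
  (forall G : zmodType, free_abelian G -> forall A : set G, A !=set0 ->
     (* (1) *)
     ((exists (a b : G) (m : nat),
         A = [set a + b *+ n | n in [set n : nat | (n <= m)%N]]) \/
      (exists (d : nat) (a : G) (b : 'I_d -> G) (m : 'I_d -> nat),
         A = progression a b (fun i => [set n : int | 0 <= n <= (m i)%:Z])) ->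
      (exists B : set G, minimal_complement A B) /\
      (exists B : set G, minimal_complement B A)) /\
     (* (2) *)
     ((exists a b : G, b != 0 /\ A = [set a + b *+ n | n in [set: nat]]) \/
      (exists (d : nat) (b : 'I_d -> G),
         free_of_rank d (generated (range b)) /\ unbounded_gap b A) ->
      [/\ ~ (exists B : set G, minimal_complement A B),
          ~ (exists B : set G, minimal_complement B A)
        & ~ (exists B : set G, minimal_pair A B \/ minimal_pair B A)])) /\
  (* (3) *)
  (forall I : Type, inhabited I -> forall a b : int, b != 0 ->
     let P : set int := [set a + b *+ n | n in [set: nat]] in
     let A : set (I -> int) := [set f | forall i, P (f i)] in
     [/\ ~ (exists B : set (I -> int), minimal_complement A B),
         ~ (exists B : set (I -> int), minimal_complement B A)
       & ~ (exists B : set (I -> int), minimal_pair A B \/ minimal_pair B A)]).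
Proof.
split=> [G frG A A0 | I inhI a b b0 P A]; last first.
  exact/shrinkable_no_minimal_pair/product_ray_shrinkable.
split=> [boxA | gapA].
  have finA : finite_set A.
    case: boxA => [[a [b [m ->]]] | [d [a [b [m ->]]]]].
      by apply: finite_image; exact: (finite_II m.+1).
    apply: progression_finite => i.
    apply: (@sub_finite_set _ _ (range (fun k : 'I_(m i).+1 => k%:Z))).
      case=> [n|n] /andP[] // _ nm; exists (inord n) => //.
      by rewrite inordK.
    by apply: finite_image; exact: finite_finset.
  split; last exact: finite_has_minimal_complement.
  (* A nonzero element makes [G] infinite, as separation requires. *)
  have [G0|/existsNP[x /eqP x0]] := pselect (forall x : G, x = 0).
    exact: trivial_is_minimal_complement.
  by apply: finite_is_minimal_complement => //; exact: free_abelian_infinite x0.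
apply: shrinkable_no_minimal_pair.
case: gapA => [[a [b [b0 ->]]] | [d [b [rkb gapA]]]].
  apply: ray_shrinkable => n; apply: contra b0 => /eqP.
  by move/(free_abelian_torsion_free frG) ->.
exact: unbounded_gap_shrinkable gapA.
Qed.
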